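(* Let $T,S$ be two strictly lower triangular matrices over $\mathbb{F}$ (of the same size). If $T\sim S$, then $\mathbb{W}(T)=\mathbb{W}(S)$.
   Context: Let $\mathbb{F}$ be a field of characteristic different from $2$. An $n$-SLTM is a strictly lower triangular $n\times n$ matrix with entries in $\mathbb{F}$; $0_n$ is the zero matrix. For an $n$-SLTM $T=[t_{ij}]$, $\mathcal{A}(T)$ is the commutative unital $\mathbb{F}$-algebra with generators $X_1,\dots,X_n$ and relations $X_1^2=0$ and $X_i^2=\sum_{j<i}t_{ij}X_jX_i$ for $2\le i\le n$, graded by $\deg(X_i)=2$. For two $n$-SLTM $T,S$, write $T\sim S$ if there is a degree-preserving isomorphism of $\mathbb{F}$-algebras $\mathcal{A}(T)\to\mathcal{A}(S)$; this is an equivalence relation. Intervals are intervals of integers: $[a,b]=\{m:a\le m\le b\}$, $[a,b[=\{m:a\le m<b\}$, $]a,b]=\{m:a<m\le b\}$. For an $n$-SLTM $T$, $T^{[r]}$ is its $r$-th row. For $r\in[1,n]$ let $c_r=\max\{j:t_{rj}\ne 0\}$ if $T^{[r]}\neq 0$ and $c_r=0$ otherwise. If $c_r>0$, $t_{r,c_r}$ is the leader of the $r$-th row and $(r,c_r)$ is its leader position. For $\alpha\in\mathbb{F}$ and $1\le i<j<k\le n$ put $\Delta^{(\alpha)}_{i,j,k}(T)=\alpha t_{ki}+t_{kj}t_{ji}$. First reduced echelon form ($1$-REF): an $n$-SLTM $S\ne 0_n$ is in $1$-REF if (1) all zero rows of $S$ are above all nonzero rows; (2) for each leader position $(r,c)$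 we have $c>1$ and there is $i_0\in[1,c[$ with $\Delta^{(2)}_{i_0,c,r}(S)\neq 0$; (3) if $(r,c_r)$ and $(r+1,c_{r+1})$ are leader positions of rows $r$ and $r+1$, then $c_r\le c_{r+1}$. The zero matrix $0_n$ is also in $1$-REF. Wall: for $S\neq 0_n$ in $1$-REF define recursively $r_1=\min\{r\in[1,n]:S^{[r]}\ne 0\}$ and, given $r_j$, let $A_j=\{r\in\,]r_j,n]: c_r\ge r_j\}$; if $A_j\neq\emptyset$ put $r_{j+1}=\min(A_j)$; if $A_j=\emptyset$ stop and put $\mathbb{W}(S)=(r_1,\dots,r_j)$. Also $\mathbb{W}(0_n)=(0)$. For an arbitrary $n$-SLTM $T$, the wall of $T$ is $\mathbb{W}(T):=\mathbb{W}(S)$, where $S$ is any $n$-SLTM in $1$-REF with $T\sim S$ (such $S$ exists and the value does not depend on the choice). *)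

(* Defs.v *)
From HB Require Import structures.
From mathcomp Require Import all_boot all_order all_algebra.
From mathcomp Require Import ring_quotient.
From mathcomp Require Import boolp.
From mathcomp Require Import mpoly.

Set Implicit Arguments.
Unset Strict Implicit.
Unset Printing Implicit Defensive.

Import GRing.Theory.
Local Open Scope ring_scope.

(* Row and column r in [1, n] is the ordinal r - 1 : 'I_n.  The natural
   numbers [leadcol S r] and the entries of walls are kept 1-based, so that the
   value 0 is free for c_r = 0 (zero row) and for W(0_n) = (0). *)

Section Algebra.
Context {F : fieldType} {n : nat}.
Implicit Types T S : 'M[F]_n.

Definition sltm T : Prop := forall i j : 'I_n, (i <= j)%N -> T i j = 0.

(* For i = 0 the sum is empty and the relation is X_1^2 = 0. *)
Definition relator T (i : 'I_n) : {mpoly F[n]} :=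
  'X_i ^+ 2 - \sum_(j < n | (j < i)%N) T i j *: ('X_j * 'X_i).

Definition in_relI T (p : {mpoly F[n]}) : Prop :=
  exists q : 'I_n -> {mpoly F[n]}, p = \sum_i q i * relator T i.

Definition relI T : {mpoly F[n]} -> bool := fun p => `[< in_relI T p >].

Lemma relator_eval0 T i : (relator T i).@[fun=> 0] = 0.
Proof.
rewrite mevalB rmorphXn /= mevalXU expr0n /= sub0r.
rewrite (raddf_sum (meval _)) big1 ?oppr0 // => j _.
by rewrite /= mevalZ mevalM mevalXU mul0r mulr0.
Qed.

Lemma relI_closed T : idealr_closed (relI T).
Proof.
split.
- apply/asboolP; exists (fun=> 0).
  by rewrite big1 // => i _; rewrite mul0r.
- apply/negP => /asboolP[q /(congr1 (meval (fun=> 0)))] /eqP.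
  rewrite meval1 (raddf_sum (meval _)) big1 ?oner_eq0 // => i _.
  by rewrite /= mevalM relator_eval0 mulr0.
- move=> a x y /asboolP[q ->] /asboolP[q' ->]; apply/asboolP.
  exists (fun i => a * q i + q' i); rewrite mulr_sumr -big_split /=.
  by apply: eq_bigr => i _; rewrite mulrDl mulrA.
Qed.

HB.instance Definition _ T :=
  isIdealr.Build {mpoly F[n]} (relI T) (relI_closed T).

Definition alg T : Type := {ideal_quot (relI T : idealr {mpoly F[n]})}.

HB.instance Definition _ T := GRing.ComNzRing.on (alg T).

Definition proj T (p : {mpoly F[n]}) : alg T :=
  (\pi_({ideal_quot (relI T : idealr {mpoly F[n]})}) p)%qT.

Lemma proj_zmod T : zmod_morphism (@proj T).
Proof. by move=> p q; rewrite /proj !piE. Qed.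

Lemma proj_monoid T : monoid_morphism (@proj T).
Proof. by split=> [|p q]; rewrite /proj !piE. Qed.

HB.instance Definition _ T :=
  GRing.isZmodMorphism.Build _ _ (@proj T) (@proj_zmod T).
HB.instance Definition _ T :=
  GRing.isMonoidMorphism.Build _ _ (@proj T) (@proj_monoid T).

Definition alg_scale T (a : F) (x : alg T) : alg T := proj T a%:MP * x.

Lemma alg_scaleA T a b (x : alg T) :
  alg_scale a (alg_scale b x) = alg_scale (a * b) x.
Proof. by rewrite /alg_scale mulrA -rmorphM /= mpolyCM. Qed.

Lemma alg_scale1 T : left_id 1 (@alg_scale T).
Proof. by move=> x; rewrite /alg_scale mpolyC1 rmorph1 mul1r. Qed.

Lemma alg_scaleDr T : right_distributive (@alg_scale T) +%R.
Proof. by move=> a x y; rewrite /alg_scale mulrDr. Qed.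

Lemma alg_scaleDl T (x : alg T) :
  {morph (@alg_scale T)^~ x : a b / a + b}.
Proof. by move=> a b; rewrite /alg_scale mpolyCD rmorphD mulrDl. Qed.

HB.instance Definition _ T := GRing.Zmodule_isLmodule.Build F (alg T)
  (@alg_scaleA T) (@alg_scale1 T) (@alg_scaleDr T) (@alg_scaleDl T).

Lemma alg_scaleAl T (a : F) (x y : alg T) : a *: (x * y) = (a *: x) * y.
Proof. exact: mulrA. Qed.

HB.instance Definition _ T :=
  GRing.Lmodule_isLalgebra.Build F (alg T) (@alg_scaleAl T).

Lemma alg_scaleAr T (a : F) (x y : alg T) : a *: (x * y) = x * (a *: y).
Proof. exact: mulrCA. Qed.

HB.instance Definition _ T :=
  GRing.Lalgebra_isAlgebra.Build F (alg T) (@alg_scaleAr T).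

(* The homogeneous component of degree d: since deg X_i = 2, a monomial of
   total exponent k has degree 2k. *)
Definition homog_elt T (d : nat) (x : alg T) : Prop :=
  exists2 p : {mpoly F[n]},
    {in msupp p, forall m, (2 * mdeg m)%N = d} & x = proj T p.

End Algebra.

Definition sltm_equiv (F : fieldType) (n : nat) (T S : 'M[F]_n) : Prop :=
  exists f : {lrmorphism alg T -> alg S},
    bijective f /\
    forall (d : nat) (x : alg T), homog_elt d x <-> homog_elt d (f x).

Section Walls.
Context {F : fieldType} {n : nat}.
Implicit Types T S : 'M[F]_n.

Definition leadcol S (r : 'I_n) : nat := \max_(j < n | S r j != 0) j.+1.

Definition leader_pos S (r c : 'I_n) : Prop := leadcol S r = c.+1.

Definition Delta (alpha : F) (i j k : 'I_n) T : F :=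
  alpha * T k i + T k j * T j i.

Definition REF1 S : Prop :=
  sltm S /\
  (S = 0 \/
   [/\ forall r r' : 'I_n, row r S = 0 -> row r' S <> 0 -> (r < r')%N,
       forall r c : 'I_n, leader_pos S r c ->
         (1 < c.+1)%N /\
         exists i0 : 'I_n, (i0 < c)%N /\ Delta 2%:R i0 c r S <> 0
     & forall r r' c c' : 'I_n, r' = r.+1 :> nat ->
         leader_pos S r c -> leader_pos S r' c' -> (c <= c')%N]).

(* [enum 'I_n] is increasing, so the head of a filtered enumeration is the
   minimum of the corresponding set. *)
Definition min_row (P : pred 'I_n) : option 'I_n :=
  ohead [seq r <- enum 'I_n | P r].

(* Rows strictly increase along the recursion, so fuel n is never exhausted. *)
Fixpoint wall_from S (fuel : nat) (r : 'I_n) : seq nat :=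
  r.+1 ::
    (if fuel is k.+1 then
       if min_row (fun r' => (r < r')%N && (r.+1 <= leadcol S r')%N) is Some r'
       then wall_from S k r' else [::]
     else [::]).

Definition wallREF S : seq nat :=
  if min_row (fun r => row r S != 0) is Some r1 then wall_from S n r1
  else [:: 0%N].

(* "w is the value of W(T)".  W(T) is W(R) for any R in 1-REF with T ~ R; both
   the existence of such an R and the independence of its choice are part of
   what it means for W(T) to have a value, so they are required here rather
   than settled by a choice operator. *)
Definition is_wall T (w : seq nat) : Prop :=
  (exists R, REF1 R /\ sltm_equiv T R) /\
  (forall R, REF1 R -> sltm_equiv T R -> wallREF R = w).

End Walls.

(* Main.v *)
Require Import Defs.
From mathcomp Require Import all_boot all_order all_algebra.
From HB Require Import structures.
From mathcomp Require Import ring_quotient boolp mpoly ring.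

(* Only the multiplication of degree-2 elements matters: A(T) and A(S) are
   isomorphic iff some invertible matrix carries the pairs (u, w) of linear forms
   with u w = 0 in A(T) onto those of A(S), because the defining quadrics are
   products of linear forms, are linearly independent, and span the kernel of
   the multiplication.

   For S in 1-REF with wall (r_1, r_2, ..), put V_0 = 0 and let V_(j+1) be the
   span of the y such that y (y - v) = 0 for some v in V_j.  Condition (2) of the
   1-REF forces V_j = span (X_i : i < r_j), so the wall is read off from the
   dimensions of an intrinsic filtration.

   To put T in 1-REF, choose linearly independent y_1, .., y_n greedily, so that
   y_k (y_k - v) = 0 with v in span (y_1, .., y_m) and m as small as possible.  If
   (2) failed at the leader t in position (r, c), then y_r - (t/2) y_c would be
   a better choice than y_r. *)

Set Implicit Arguments.
Unset Strict Implicit.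
Unset Printing Implicit Defensive.

Import GRing.Theory.
Local Open Scope ring_scope.

(** * Products of linear forms modulo the relations *)

Section LinearForms.
Context {F : fieldType} {n : nat}.
Implicit Types (T S M : 'M[F]_n) (u v w : 'rV[F]_n) (p q : {mpoly F[n]}).

Definition lin u : {mpoly F[n]} := \sum_i u 0 i *: 'X_i.

Lemma lin_is_linear : linear lin.
Proof.
move=> a u v; rewrite /lin scaler_sumr -big_split /=; apply: eq_bigr => i _.
by rewrite !mxE scalerDl scalerA.
Qed.

HB.instance Definition _ :=
  GRing.isLinear.Build F 'rV[F]_n {mpoly F[n]} _ lin lin_is_linear.

Lemma lin_delta i : lin (delta_mx 0 i) = 'X_i.
Proof.
rewrite /lin (bigD1 i) //= mxE !eqxx scale1r big1 ?addr0 // => j neq_ji.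
by rewrite mxE (negbTE neq_ji) andbF scale0r.
Qed.

Lemma meval0_lin u : (lin u).@[fun=> 0] = 0.
Proof.
rewrite (raddf_sum (meval _)) big1 // => i _.
by rewrite /= mevalZ mevalXU mulr0.
Qed.

Lemma mderiv_lin i u : (lin u)^`M(i) = (u 0 i)%:MP.
Proof.
rewrite (raddf_sum (mderiv i)) (bigD1 i) //= big1 => [|j neq_ji].
  rewrite addr0 mderivZ mderivX mnm1E eqxx scale1r.
  have -> : (U_(i) - U_(i))%MM = 0%MM :> 'X_{1..n}.
    by apply/mnmP => k; rewrite mnmBE mnm0E subnn.
  by rewrite mpolyX0 alg_mpolyC.
by rewrite mderivZ mderivX mnm1E (negbTE neq_ji) scale0r scaler0.
Qed.

Lemma homog1_lin p : p \is 1.-homog -> exists u, p = lin u.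
Proof.
move/dhomogP=> /= p1; move: p1; rewrite {2}[p]mpolyE.
elim: (msupp p) => [|m s IHs] p1; first by exists 0; rewrite big_nil raddf0.
have [u def_u] : exists u, \sum_(m <- s) p@_m *: 'X_[m] = lin u.
  by apply: IHs => m' s_m'; rewrite p1 // inE s_m' orbT.
have /eqP := p1 m (mem_head _ _); rewrite mdeg_eq1 => /existsP[i /eqP ->].
exists (p@_U_(i) *: delta_mx 0 i + u).
by rewrite big_cons def_u linearP /= lin_delta.
Qed.

Lemma lin_homog u : lin u \is 1.-homog.
Proof. by rewrite rpred_sum // => i _; rewrite rpredZ // dhomogX /= mdeg1. Qed.

(* Coefficient of X_j X_i (j < i) in the product of the linear forms u and w of
   A(T), after X_i^2 has been eliminated. *)
Definition prodcoef T u w (i j : 'I_n) : F :=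
  u 0 i * w 0 i * T i j + u 0 i * w 0 j + u 0 j * w 0 i.

Definition zprod T u w : Prop :=
  forall i j : 'I_n, (j < i)%N -> prodcoef T u w i j = 0.

Lemma relatorE T i : sltm T ->
  relator T i = lin (delta_mx 0 i) * lin (delta_mx 0 i - row i T).
Proof.
move=> hT; rewrite linearB /= lin_delta mulrBr -expr2 /relator; congr (_ - _).
rewrite /lin mulr_sumr [RHS](bigID (fun j : 'I_n => (j < i)%N)) /=.
rewrite [X in _ = _ + X]big1 ?addr0 => [|j]; last first.
  by rewrite -leqNgt => le_ij; rewrite mxE hT // scale0r mulr0.
by apply: eq_bigr => j _; rewrite mxE -scalerAr mulrC.
Qed.

Lemma lin_mulE T u w : sltm T ->
  lin u * lin w = \sum_i (u 0 i * w 0 i) *: relator T i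
     + \sum_(i < n) \sum_(j < n | (j < i)%N) prodcoef T u w i j *: ('X_j * 'X_i).
Proof.
move=> hT; rewrite /lin -big_split /= mulr_suml.
pose G i j := (u 0 i * w 0 j) *: ('X_i * 'X_j) : {mpoly F[n]}.
have -> : \sum_i u 0 i *: 'X_i * (\sum_j w 0 j *: 'X_j) = \sum_i \sum_j G i j.
  apply: eq_bigr => i _; rewrite mulr_sumr; apply: eq_bigr => j _.
  by rewrite -scalerAl -scalerAr scalerA.
(* The off-diagonal terms are paired as [(i, j)] with [(j, i)] for [j < i], leaving the squares to
   be traded for relators. *)
have -> : \sum_i \sum_j G i j =
    \sum_(i < n) (G i i + \sum_(j < n | (j < i)%N) (G i j + G j i)).
  under eq_bigr => i _ do rewrite (bigD1 i) //= (bigID (fun j : 'I_n => (j < i)%N)) /=.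
  rewrite !big_split /=; congr (_ + _).
  under [in RHS]eq_bigr => i _ do rewrite big_split.
  rewrite [RHS]big_split /=; congr (_ + _).
    apply: eq_bigr => i _; apply: eq_bigl => j.
    by apply: andb_idl => lt_ji; rewrite -val_eqE neq_ltn lt_ji.
  rewrite [RHS](exchange_big_dep xpredT) //=; apply: eq_bigr => i _.
  apply: eq_bigl => j; rewrite -leqNgt -val_eqE eq_sym.
  by rewrite [RHS]ltn_neqAle.
apply: eq_bigr => i _; rewrite /relator scalerBr [in LHS]/G -expr2 -addrA; congr (_ + _).
rewrite scaler_sumr -sumrN -big_split /=; apply: eq_bigr => j _.
rewrite /prodcoef /G [_ * 'X_j]mulrC -scalerDl scalerA -scaleNr -scalerDl.
by congr (_ *: _); ring.
Qed.

(* Second-order Taylor coefficients at 0 separate the quadratic part of the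
   relations from their higher multiples. *)
Definition hess0 i j p := p^`M(i)^`M(j).@[fun=> 0].

(** Both linear factors vanish at 0, so only the Leibniz terms differentiating each of them once
    survive, and [q] enters through its constant term alone. *)
Lemma hess0_mul_lin i j q u w :
  hess0 i j (q * (lin u * lin w)) =
  q.@[fun=> 0] * (u 0 i * w 0 j + u 0 j * w 0 i).
Proof.
rewrite /hess0 !(mderivM, mderivD, mderiv_lin, mderivC).
rewrite !(mevalD, mevalM, meval0_lin, mevalC, meval0); ring.
Qed.

Lemma hess0_sum i j (r : 'I_n -> {mpoly F[n]}) :
  hess0 i j (\sum_k r k) = \sum_k hess0 i j (r k).
Proof.
rewrite /hess0 (raddf_sum (mderiv i)) (raddf_sum (mderiv j)).
exact: (raddf_sum (meval _)).
Qed.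

Lemma mderiv_mul_lin i q u w : (q * (lin u * lin w))^`M(i).@[fun=> 0] = 0.
Proof.
rewrite !(mderivM, mderiv_lin).
by rewrite !(mevalD, mevalM, meval0_lin, mulr0, mul0r, addr0).
Qed.


Lemma zprod_in_relI T u w : sltm T -> zprod T u w ->
  lin u * lin w = \sum_i (u 0 i * w 0 i) *: relator T i.
Proof.
move=> hT uw0; rewrite (lin_mulE _ _ hT) [X in _ + X]big1 ?addr0 // => i _.
by rewrite big1 // => j lt_ji; rewrite uw0 // scale0r.
Qed.

Lemma in_relI_zprod T u w : sltm T -> 2%:R != 0 :> F ->
  in_relI T (lin u * lin w) -> zprod T u w.
Proof.
move=> hT nz2 [q def_uw] i j lt_ji.
(* This weighting of second derivatives is [2 * prodcoef] on a product of linear forms; it kills all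
   multiples of the relators, which are such products with [prodcoef] equal to 0. *)
pose phi p := 2%:R * hess0 i j p + T i j * hess0 i i p.
have phi_sum (r : 'I_n -> {mpoly F[n]}) : phi (\sum_k r k) = \sum_k phi (r k).
  by rewrite /phi !hess0_sum !mulr_sumr -big_split.
have phi_form r v z :
    phi (r * (lin v * lin z)) = r.@[fun=> 0] * (2%:R * prodcoef T v z i j).
  by rewrite /phi !hess0_mul_lin /prodcoef; ring.
have := phi_form 1 u w; rewrite mul1r meval1 mul1r def_uw phi_sum big1 => [|k _].
  by move/esym/eqP; rewrite mulf_eq0 (negbTE nz2) => /eqP.
rewrite relatorE // phi_form.
suff -> : prodcoef T (delta_mx 0 k) (delta_mx 0 k - row k T) i j = 0.
  by rewrite !mulr0.
rewrite /prodcoef !mxE !eqxx /=.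
have [eq_ik|neq_ik] := eqVneq i k; last first.
  have [eq_jk|neq_jk] := eqVneq j k; last by rewrite !mul0r !addr0.
  subst k; rewrite (hT j i) 1?ltnW // !mulr0n mulr1n; ring.
subst k; have /negbTE -> : j != i by rewrite -val_eqE neq_ltn lt_ji.
by rewrite (hT i i) // mulr0n mulr1n; ring.
Qed.

Lemma zprodP T u w : sltm T -> 2%:R != 0 :> F ->
  zprod T u w <-> in_relI T (lin u * lin w).
Proof.
move=> hT nz2; split; last exact: in_relI_zprod.
move=> uw0; exists (fun i => (u 0 i * w 0 i)%:MP); rewrite (zprod_in_relI hT) //.
by apply: eq_bigr => i _; rewrite mul_mpolyC.
Qed.

Lemma zprod_relator T i : sltm T -> 2%:R != 0 :> F ->
  zprod T (delta_mx 0 i) (delta_mx 0 i - row i T).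
Proof.
move=> hT nz2; apply/zprodP => //; exists (fun k => (k == i)%:R).
rewrite -relatorE // (bigD1 i) //= eqxx mul1r big1 ?addr0 // => k /negbTE ->.
by rewrite mul0r.
Qed.

(** Relators are products of two linear forms, so every element of the ideal has zero gradient at
    the origin, while the gradient of [lin u] is [u]. *)
Lemma in_relI_lin T u : sltm T -> in_relI T (lin u) -> u = 0.
Proof.
move=> hT [q def_u]; apply/rowP => i; rewrite mxE.
have <- : (lin u)^`M(i).@[fun=> 0] = u 0 i by rewrite mderiv_lin mevalC.
rewrite def_u (raddf_sum (mderiv _)) (raddf_sum (meval _)) big1 // => k _.
by rewrite /= relatorE // mderiv_mul_lin.
Qed.

(** The second derivative in [X_i] at 0 is 2 on the [i]-th relator and 0 on the others, so it
    isolates the [i]-th coefficient. *)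
Lemma relator_free T u : sltm T -> 2%:R != 0 :> F ->
  \sum_i u 0 i *: relator T i = 0 -> u = 0.
Proof.
move=> hT nz2 u0; apply/rowP => i; rewrite mxE.
have : hess0 i i (\sum_k u 0 k *: relator T k) = 0.
  by rewrite u0 /hess0 !mderiv0 meval0.
rewrite hess0_sum (bigD1 i) //= big1 => [|k neq_ki].
  rewrite addr0 -mul_mpolyC relatorE // hess0_mul_lin mevalC.
  rewrite !mxE !eqxx hT //= => /eqP; rewrite mulf_eq0 => /orP[/eqP //|].
  by rewrite subr0 !mulr1 -[_ + _]/2%:R (negbTE nz2).
rewrite -mul_mpolyC relatorE // hess0_mul_lin.
by rewrite !mxE [i == k]eq_sym (negbTE neq_ki) !mul0r addr0 mulr0.
Qed.

(** * Linear substitutions of polynomials *)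

Definition subst M p : {mpoly F[n]} := p \mPo [tuple lin (row i M) | i < n].

HB.instance Definition _ M := GRing.LRMorphism.copy (subst M)
  (comp_mpoly [tuple lin (row i M) | i < n]).

Lemma subst_X M i : subst M 'X_i = lin (row i M).
Proof. by rewrite /subst comp_mpolyXU -tnth_nth tnth_mktuple. Qed.

Lemma subst_lin M u : subst M (lin u) = lin (u *m M).
Proof.
rewrite {1}/lin raddf_sum mulmx_sum_row (raddf_sum lin) /=; apply: eq_bigr => i _.
by rewrite linearZ /= subst_X linearZ.
Qed.

Lemma subst_cancel M N : M *m N = 1%:M -> cancel (subst M) (subst N).
Proof.
move=> MN1 p; rewrite [p]mpolyE (raddf_sum (subst M)) (raddf_sum (subst N)) /=.
apply: eq_bigr => m _.
rewrite !linearZ /=; congr (_ *: _); rewrite mpolyXE_id !rmorph_prod /=.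
apply: eq_bigr => i _; rewrite !rmorphXn /= subst_X subst_lin.
by rewrite -row_mul MN1 row1 lin_delta.
Qed.

Lemma subst_homog M p d : p \is d.-homog -> subst M p \is d.-homog.
Proof.
move=> /dhomogP hp; rewrite [p]mpolyE (raddf_sum (subst M)) /= big_seq.
rewrite rpred_sum // => m pm; rewrite linearZ /= rpredZ //.
have <- : mdeg m = d := hp m pm.
rewrite mpolyXE_id rmorph_prod /= mdegE.
elim/big_rec2: _ => [|i x y _ hx]; first exact: dhomog1.
by rewrite rmorphXn /= subst_X dhomogM // -{2}[m i]mul1n dhomogMn // lin_homog.
Qed.

End LinearForms.

(** * From substitutions to algebra isomorphisms, and back *)

Section Descent.
Context {F : fieldType} {n : nat}.
Implicit Types (T S M : 'M[F]_n) (u v w : 'rV[F]_n) (p q : {mpoly F[n]}).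

Lemma proj_eq T p q : proj T p = proj T q <-> in_relI T (p - q).
Proof.
split=> [/eqP|pq].
  by rewrite /proj -Quotient.idealrBE => /asboolP.
by apply/eqP; rewrite /proj -Quotient.idealrBE; apply/asboolP.
Qed.

Lemma proj_eq0 T p : proj T p = 0 <-> in_relI T p.
Proof. by rewrite -[0](rmorph0 (proj T)) proj_eq subr0. Qed.

Lemma proj_surj T (x : alg T) : exists p, x = proj T p.
Proof. by exists (repr x); rewrite /proj reprK. Qed.

Lemma proj_scale T a p : proj T (a *: p) = a *: proj T p.
Proof. by rewrite -mul_mpolyC rmorphM. Qed.

(* The proof argument is a parameter only so that the morphism instances of
   [descend] can be inferred. *)
Definition descend T S M (_ : forall p, in_relI T p -> in_relI S (subst M p))
  (x : alg T) : alg S := proj S (subst M (repr x)).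

Section Lift.
Variables (T S M : 'M[F]_n).
Hypothesis MTS : forall p, in_relI T p -> in_relI S (subst M p).

Lemma descend_proj p : descend MTS (proj T p) = proj S (subst M p).
Proof.
apply/proj_eq; rewrite -(raddfB (subst M)); apply/MTS/proj_eq.
by rewrite /proj reprK.
Qed.

Lemma descend_zmod : zmod_morphism (descend MTS).
Proof.
move=> x y; have [p ->] := proj_surj x; have [q ->] := proj_surj y.
by rewrite -rmorphB !descend_proj !rmorphB.
Qed.

Lemma descend_monoid : monoid_morphism (descend MTS).
Proof.
split=> [|x y]; first by rewrite -[1](rmorph1 (proj T)) descend_proj !rmorph1.
have [p ->] := proj_surj x; have [q ->] := proj_surj y.
by rewrite -rmorphM !descend_proj !rmorphM.
Qed.

Lemma descend_scalable : scalable (descend MTS).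
Proof.
move=> a x; have [p ->] := proj_surj x.
by rewrite -proj_scale !descend_proj linearZ proj_scale.
Qed.

HB.instance Definition _ :=
  GRing.isZmodMorphism.Build _ _ (descend MTS) descend_zmod.
HB.instance Definition _ :=
  GRing.isMonoidMorphism.Build _ _ (descend MTS) descend_monoid.
HB.instance Definition _ :=
  GRing.isScalable.Build F (alg T) (alg S) *:%R (descend MTS) descend_scalable.

Lemma descend_homog d x : homog_elt d x -> homog_elt d (descend MTS x).
Proof.
move=> [p hp ->]; exists (subst M p); last exact: descend_proj.
(* The zero polynomial is set apart because its support is empty and gives no monomial from which to
   read off [d]. *)
have [->|p0] := eqVneq p 0; first by rewrite raddf0 msupp0.
have def_d : (2 * mdeg (mlead p))%N = d by apply/hp/mlead_supp.
have /(subst_homog M)/dhomogP hM : p \is (mdeg (mlead p)).-homog.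
  by apply/dhomogP => m /hp; rewrite -def_d => /eqP; rewrite eqn_pmul2l // => /eqP.
by move=> m /hM /= ->.
Qed.

End Lift.

Lemma descend_cancel T S M N
    (hM : forall p, in_relI T p -> in_relI S (subst M p))
    (hN : forall p, in_relI S p -> in_relI T (subst N p)) :
  M *m N = 1%:M -> cancel (descend hM) (descend hN).
Proof.
move=> MN1 x; have [p ->] := proj_surj x.
by rewrite !descend_proj subst_cancel.
Qed.

Lemma sltm_equiv_descend T S M N : M *m N = 1%:M ->
  (forall p, in_relI T p -> in_relI S (subst M p)) ->
  (forall p, in_relI S p -> in_relI T (subst N p)) ->
  sltm_equiv T S.
Proof.
move=> MN1 hM hN; have NM1 := mulmx1C MN1.
exists (descend hM : {lrmorphism alg T -> alg S}); split.
  by exists (descend hN); apply: descend_cancel.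
move=> d x; split=> [|hx]; first exact: descend_homog.
by rewrite -(descend_cancel hM hN MN1 x); apply: descend_homog.
Qed.

Lemma in_relI_subst T S M :
  (forall i, in_relI S (subst M (relator T i))) ->
  forall p, in_relI T p -> in_relI S (subst M p).
Proof.
move=> hM p [q ->]; have [r hr] := fin_all_exists hM.
exists (fun k => \sum_i subst M (q i) * r i k).
rewrite (raddf_sum (subst M)) /=.
under eq_bigr => i _ do rewrite rmorphM /= hr mulr_sumr.
rewrite exchange_big /=; apply: eq_bigr => k _.
by rewrite mulr_suml; apply: eq_bigr => i _; rewrite mulrA.
Qed.

Lemma in_relI_comb T (u : 'rV[F]_n) : in_relI T (\sum_i u 0 i *: relator T i).
Proof.
by exists (fun i => (u 0 i)%:MP); apply: eq_bigr => i _; rewrite mul_mpolyC.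
Qed.

(** The hypothesis says that the images of the two linear factors of each relator of [T] have
    product 0 in A(S). So [subst M] sends relators of [T] to combinations of relators of [S], with
    coefficient matrix [C]; inverting [C] shows that the inverse substitution respects the ideals
    too. *)
Lemma sltm_equiv_of_zprod T S M : 2%:R != 0 :> F -> sltm T -> sltm S ->
  M \in unitmx -> (forall k, zprod S (row k M) (row k (M - T *m M))) ->
  sltm_equiv T S.
Proof.
move=> nz2 hT hS uM hM; pose N := invmx M.
have MN1 : M *m N = 1%:M by rewrite mulmxV.
pose C := \matrix_(k, i) (M k i * (M - T *m M) k i).
have substC k : subst M (relator T k) = \sum_i C k i *: relator S i.
  rewrite relatorE // rmorphM /= !subst_lin mulmxBl -row_mul -rowE -linearB /=.
  rewrite (zprod_in_relI hS (hM k)); apply: eq_bigr => i _.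
  by rewrite !mxE.
have substC' (u : 'rV_n) : subst M (\sum_k u 0 k *: relator T k) =
    \sum_i (u *m C) 0 i *: relator S i.
  rewrite (raddf_sum (subst M)) /=.
  under eq_bigr => k _ do rewrite linearZ /= substC scaler_sumr.
  rewrite exchange_big /=; apply: eq_bigr => i _.
  by rewrite !mxE scaler_suml; apply: eq_bigr => k _; rewrite scalerA.
(* The relators are linearly independent, so the image of their span under
   the substitution is the full span of the relators of S. *)
have uC : C \in unitmx.
  rewrite -row_free_unit -kermx_eq0; apply/eqP/row_matrixP => k.
  rewrite row0; apply: (relator_free hT nz2); apply: (can_inj (subst_cancel MN1)).
  rewrite substC' -row_mul mulmx_ker row0 raddf0.
  by rewrite big1 // => i _; rewrite mxE scale0r.
apply: (sltm_equiv_descend MN1); apply: in_relI_subst => i.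
  have := in_relI_comb S (row i C).
  rewrite substC; congr in_relI; apply: eq_bigr => k _; by rewrite mxE.
have -> : relator S i = subst M (\sum_k (invmx C) i k *: relator T k).
  rewrite (eq_bigr (fun k => row i (invmx C) 0 k *: relator T k)) => [|k _].
    rewrite substC' -row_mul mulVmx // (bigD1 i) //= big1 => [|j neq_ji].
      by rewrite !mxE eqxx scale1r addr0.
    by rewrite !mxE [i == j]eq_sym (negbTE neq_ji) scale0r.
  by rewrite mxE.
rewrite (subst_cancel MN1) (eq_bigr (fun k => row i (invmx C) 0 k *: relator T k)).
  exact: in_relI_comb.
by move=> k _; rewrite mxE.
Qed.


Lemma homog2_lin T (x : alg T) : homog_elt 2 x -> exists u, x = proj T (lin u).
Proof.
move=> [p hp ->]; have [u ->] : exists u, p = lin u; last by exists u.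
apply/homog1_lin/dhomogP => m /hp/eqP.
by rewrite -{2}[2%N]muln1 eqn_pmul2l // => /eqP.
Qed.

Lemma homog2_proj T u : homog_elt 2 (proj T (lin u)).
Proof. by exists (lin u) => // m; have /dhomogP h := lin_homog u; move/h => /= ->. Qed.

(** The degree-2 component consists of the images of linear forms, so an isomorphism acts on it by a
    matrix; being injective, it both preserves and reflects zero products. *)
Lemma sltm_equiv_zprod T S : 2%:R != 0 :> F -> sltm T -> sltm S ->
  sltm_equiv T S -> exists2 M, M \in unitmx &
    forall u w, zprod T u w <-> zprod S (u *m M) (w *m M).
Proof.
move=> nz2 hT hS [f [[g fK gK] hf]].
have /fin_all_exists[r hr] k : exists v, f (proj T (lin (delta_mx 0 k))) = proj S (lin v).
  by apply/homog2_lin/hf/homog2_proj.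
have /fin_all_exists[r' hr'] k : exists v, g (proj S (lin (delta_mx 0 k))) = proj T (lin v).
  by apply/homog2_lin/hf; rewrite gK; apply: homog2_proj.
pose M := \matrix_k r k; pose N := \matrix_k r' k.
have fM u : f (proj T (lin u)) = proj S (lin (u *m M)).
  rewrite [u in LHS]row_sum_delta mulmx_sum_row !(raddf_sum lin) !raddf_sum /=.
  apply: eq_bigr => k _; rewrite !linearZ /= !proj_scale linearZ /= hr.
  by rewrite rowK.
(* Linear forms embed in A(S), so the identity [f (g x) = x] on generators becomes an identity of
   matrices. *)
have MN1 : N *m M = 1%:M.
  apply/row_matrixP => k; rewrite row1 row_mul rowK; apply/eqP; rewrite -subr_eq0.
  apply/eqP/(in_relI_lin hS); rewrite linearB; apply/proj_eq.
  by rewrite -fM -hr' gK.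
exists M; first by case/mulmx1_unit: MN1.
move=> u w; rewrite !zprodP // -!proj_eq0.
have <- : f (proj T (lin u * lin w)) = proj S (lin (u *m M) * lin (w *m M)).
  by rewrite !rmorphM /= !fM.
split=> [->|]; first exact: rmorph0.
by rewrite -[0 in X in X -> _](rmorph0 f) => /(can_inj fK).
Qed.

End Descent.

(** * Isomorphism as an equivalence relation, and leader columns *)

Section Equivalence.
Context {F : fieldType} {n : nat}.
Hypothesis nz2 : 2%:R != 0 :> F.
Implicit Types (T S M : 'M[F]_n) (u v w : 'rV[F]_n).

Lemma row_sub_mul T M k :
  row k (M - T *m M) = (delta_mx 0 k - row k T) *m M.
Proof. by rewrite linearB mulmxBl -row_mul -rowE. Qed.

Lemma sltm_equivP T S : sltm T -> sltm S ->
  sltm_equiv T S <-> exists2 M, M \in unitmx &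
    forall u w, zprod T u w <-> zprod S (u *m M) (w *m M).
Proof.
move=> hT hS; split=> [|[M uM hM]]; first exact: sltm_equiv_zprod.
apply: (sltm_equiv_of_zprod (M := M)) => // k.
by rewrite row_sub_mul [row k M]rowE; apply/hM/zprod_relator.
Qed.

Lemma sltm_equiv_sym T S : sltm T -> sltm S -> sltm_equiv T S -> sltm_equiv S T.
Proof.
move=> hT hS /sltm_equivP[] // M uM hM; apply/sltm_equivP => //.
exists (invmx M) => [|u w]; first by rewrite unitmx_inv.
by apply: iff_sym; rewrite hM !mulmxKV.
Qed.

Lemma sltm_equiv_trans T S R : sltm T -> sltm S -> sltm R ->
  sltm_equiv T S -> sltm_equiv S R -> sltm_equiv T R.
Proof.
move=> hT hS hR /sltm_equivP[] // M uM hM /sltm_equivP[] // N uN hN.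
apply/sltm_equivP => //; exists (M *m N) => [|u w]; first by rewrite unitmx_mul uM.
by rewrite hM hN !mulmxA.
Qed.

Lemma leadcol_leP S r m :
  reflect (forall j : 'I_n, (m <= j)%N -> S r j = 0) (leadcol S r <= m)%N.
Proof.
apply: (iffP (bigmax_leqP _ _ _)) => [h j le_mj|h j].
  by apply/eqP; apply: contraTT le_mj => /h; rewrite -ltnNge.
by apply: contraNT; rewrite -ltnNge ltnS => /h ->.
Qed.

Lemma leader_neq0 S (r c : 'I_n) : leader_pos S r c -> S r c != 0.
Proof.
move=> lead; apply/eqP => Src0; have: (leadcol S r <= c)%N.
  apply/leadcol_leP => j; rewrite leq_eqVlt => /orP[/eqP/val_inj <- //|].
  by apply/leadcol_leP; rewrite lead.
by rewrite lead ltnn.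
Qed.

Lemma leadcol_eq0 S r : (leadcol S r == 0%N) = (row r S == 0).
Proof.
rewrite -leqn0; apply/leadcol_leP/eqP => [h|h j _].
  by apply/rowP => j; rewrite !mxE h.
by move/rowP/(_ j): h; rewrite !mxE.
Qed.

Lemma leadcol_sltm S (r : 'I_n) : sltm S -> (leadcol S r <= r)%N.
Proof. by move=> hS; apply/leadcol_leP => j; apply: hS. Qed.

Lemma leadcol_ltn S (r : 'I_n) a : (a < leadcol S r)%N ->
  exists2 c : 'I_n, leader_pos S r c & (a <= c)%N.
Proof.
have: (leadcol S r <= n)%N by apply/leadcol_leP => j; rewrite leqNgt ltn_ord.
rewrite /leader_pos; case: (leadcol S r) => // c lt_cn lt_ac.
by exists (Ordinal lt_cn).
Qed.

(* In A(T): (u - a c)(u - a c + a l) = u (u - 2 a c + a l) + a^2 c (c - l). *)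
Lemma zprod_clear_leader T u (c l : 'rV[F]_n) a :
  zprod T u (u - (a *+ 2 *: c - a *: l)) -> zprod T c (c - l) ->
  zprod T (u - a *: c) (u - a *: c + a *: l).
Proof.
move=> hu hc i j lt_ji.
transitivity (prodcoef T u (u - (a *+ 2 *: c - a *: l)) i j
              + a ^+ 2 * prodcoef T c (c - l) i j).
  by rewrite /prodcoef !mxE; ring.
by rewrite hu // hc // mulr0 addr0.
Qed.

(** * Spans of initial rows and the greedy choice of a basis *)

Lemma row_pid_mul m M i : row i (pid_mx m *m M) = if (i < m)%N then row i M else 0.
Proof.
apply/rowP => j; rewrite !mxE (bigD1 i) //= big1 => [|k neq_ki].
  by rewrite !mxE eqxx addr0; case: ifP => _; rewrite ?mul1r ?mul0r !mxE.
by rewrite !mxE eq_sym val_eqE (negbTE neq_ki) mul0r.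
Qed.

Lemma sub_pid_mx m u : (u <= (pid_mx m : 'M[F]_n))%MS ->
  forall j : 'I_n, (m <= j)%N -> u 0 j = 0.
Proof.
case/submxP=> D -> j le_mj; rewrite mxE big1 // => k _; rewrite mxE.
by case: eqP => [->|_] /=; rewrite ?ltnNge ?le_mj mulr0.
Qed.

Lemma vanish_sub_pid_mx m u : (forall j : 'I_n, (m <= j)%N -> u 0 j = 0) ->
  u *m (pid_mx m : 'M[F]_n) = u.
Proof.
move=> hu; apply/rowP => j; rewrite mxE (bigD1 j) //= big1 => [|k neq_kj].
  rewrite mxE eqxx addr0 /=; case: ltnP => [_|le_mj]; first exact: mulr1.
  by rewrite mulr0 hu.
by rewrite mxE val_eqE (negbTE neq_kj) mulr0.
Qed.

(** [pid_mx m *m M] has as row space the span of the first [m] rows of [M]. Thus [y] is a candidate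
    for row [i] of the basis, and [m] bounds the leader column that it would produce. *)
Definition adm T M (i m : nat) : Prop := exists y v : 'rV[F]_n,
  [/\ ~~ (y <= (pid_mx i : 'M_n) *m M)%MS, (v <= (pid_mx m : 'M_n) *m M)%MS
    & zprod T y (y - v)].

(** Take the first generator [X_i] outside the span [U] of the first [k] rows. All earlier
    generators lie in [U], hence so does [row i T], and the [i]-th relator provides the zero
    product. *)
Lemma adm_full T M k : sltm T -> (\rank ((pid_mx k : 'M_n) *m M) < n)%N ->
  adm T M k k.
Proof.
move=> hT rk_lt; set U := _ *m M in rk_lt.
pose P (i : 'I_n) := ~~ ((delta_mx 0 i : 'rV[F]_n) <= U)%MS.
have [i0 Pi0 | P0] := pickP P; last first.
  have /mxrankS : (1%:M <= U)%MS.
    by apply/row_subP => i; rewrite row1; apply: negbFE (P0 i).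
  by rewrite mxrank1 leqNgt rk_lt.
have [i Pi min_i] := arg_minnP val Pi0.
exists (delta_mx 0 i), (row i T); split => //; last exact: zprod_relator.
rewrite [row i T]row_sum_delta summx_sub // => j _; rewrite mxE.
have [le_ij|lt_ji] := leqP i j; first by rewrite hT // scale0r sub0mx.
rewrite scalemx_sub //; apply: contraTT lt_ji => Pj.
by rewrite -leqNgt min_i.
Qed.

(** Induction on the number [k] of rows already chosen, the others being zero. Row [k] becomes a
    vector realizing the least admissible [m]; earlier minimality statements survive because they
    involve only the first [k] rows. *)
Lemma greedy_prefix T k : sltm T -> (k <= n)%N -> exists M,
  [/\ forall i : 'I_n, (k <= i)%N -> row i M = 0,
      (k <= \rank M)%N
    & forall i : 'I_n, (i < k)%N -> exists2 m, (m <= i)%N &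
        (exists2 v : 'rV[F]_n, (v <= (pid_mx m : 'M_n) *m M)%MS
            & zprod T (row i M) (row i M - v))
        /\ forall m', (m' < m)%N -> ~ adm T M i m'].
Proof.
move=> hT; elim: k => [_|k IHk lt_kn].
  by exists 0; split=> // i _; rewrite row0.
have [M [M0 rkM hM]] := IHk (ltnW lt_kn).
have pidkM : (pid_mx k : 'M_n) *m M = M.
  apply/row_matrixP => i; rewrite row_pid_mul.
  by case: ltnP => // /M0 ->.
have admk : exists m, `[< adm T M k m >].
  exists k; apply/asboolP/adm_full => //; rewrite (leq_ltn_trans _ lt_kn) //.
  rewrite (leq_trans (mxrankM_maxl _ _)) // rank_pid_mx ?(ltnW lt_kn) //.
case: (ex_minnP admk) => m /asboolP[y [v [yU vU yv0]]] min_m.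
have le_mk : (m <= k)%N.
  apply: min_m; apply/asboolP/adm_full => //; rewrite (leq_ltn_trans _ lt_kn) //.
  rewrite (leq_trans (mxrankM_maxl _ _)) // rank_pid_mx ?(ltnW lt_kn) //.
pose i0 := Ordinal lt_kn; pose M' := M + delta_mx i0 0 *m y.
have rowM' i : row i M' = if i == i0 then y else row i M.
  rewrite linearD /= row_mul rowE mul_delta_mx_cond.
  have [->|neq_i] := eqVneq i i0; last by rewrite mulr0n mul0mx addr0.
  by rewrite M0 // add0r mulr1n -rowE; apply/rowP => j; rewrite !mxE.
have pidM' l : (l <= k)%N -> (pid_mx l : 'M_n) *m M' = pid_mx l *m M.
  move=> le_lk; apply/row_matrixP => i; rewrite !row_pid_mul rowM'.
  by case: eqP => // ->; rewrite ltnNge le_lk.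
exists M'; split=> [i lt_ki||i le_ik].
- by rewrite rowM' -val_eqE /= gtn_eqF // M0 // ltnW.
(* The rank grows because [y] was chosen outside the row space of [M]. *)
- have: (M < M')%MS; last by rewrite ltmxErank => /andP[_]; apply: leq_ltn_trans.
  rewrite ltmxE; apply/andP; split.
    apply/row_subP => i; have [->|neq_i] := eqVneq i i0; first by rewrite M0 ?sub0mx.
    by have := row_sub i M'; rewrite rowM' (negbTE neq_i).
  apply: contra yU => M'M; rewrite pidkM (submx_trans _ M'M) //.
  by have := row_sub i0 M'; rewrite rowM' eqxx.
rewrite rowM'; have [->|neq_i] := eqVneq i i0.
  exists m => //; split=> [|m' lt_m'm]; first by exists v => //; rewrite pidM'.
  move=> hadm; have /min_m : `[< adm T M k m' >]; last by rewrite leqNgt lt_m'm.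
  apply/asboolP; case: hadm => y' [v' []]; rewrite !pidM' // => [*|]; first by exists y', v'.
  exact: ltnW (leq_trans lt_m'm le_mk).
have lt_ik : (i < k)%N by move: neq_i; rewrite -val_eqE ltn_neqAle /= => ->.
have [l le_li [hv min_l]] := hM i lt_ik; exists l => //.
have le_lk := leq_trans le_li (ltnW lt_ik).
split=> [|m' lt_m'l [y' [v' []]]]; first by rewrite pidM'.
rewrite !pidM' ?(ltnW lt_ik) // ?(leq_trans (ltnW lt_m'l)) // => *.
by apply: (min_l _ lt_m'l); exists y', v'.
Qed.

(* Row i of S holds the coordinates, in the basis of rows y_k of M, of the v with
   y_i (y_i - v) = 0; m_ i is the least m allowing v in span (y_k : k < m) for
   some choice of y_i outside span (y_k : k < i). *)
Lemma greedy_basis T : sltm T -> exists M (S : 'M[F]_n) (m_ : 'I_n -> nat),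
  [/\ M \in unitmx, forall i, (m_ i <= i)%N,
      forall i j : 'I_n, (m_ i <= j)%N -> S i j = 0,
      forall i, zprod T (row i M) (row i (M - S *m M))
    & forall (i j : 'I_n) m' u w, (m' < m_ i)%N -> (i <= j)%N -> u 0 j != 0 ->
        (forall l : 'I_n, (m' <= l)%N -> w 0 l = 0) ->
        ~ zprod T (u *m M) ((u - w) *m M)].
Proof.
move=> hT; have [M [_ rkM hM]] := greedy_prefix hT (leqnn n).
have freeM : row_free M by rewrite /row_free eqn_leq rank_leq_row.
have uM : M \in unitmx by rewrite -row_free_unit.
have /fin_all_exists2[m_ le_m /all_and2[hv min_m]] i := hM i (ltn_ord i).
have /fin_all_exists2[v_ v_sub hv_] i := hv i.
pose S := \matrix_i (v_ i *m invmx M).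
have S_sub i : (row i S <= (pid_mx (m_ i) : 'M_n))%MS.
  by rewrite rowK -(submxMfree _ _ freeM) mulmxKV.
exists M, S, m_; split=> // [i j le_mj|i|i j m' u w lt_m' le_ij uj w0 uw0].
- by have := sub_pid_mx (S_sub i) le_mj; rewrite mxE.
- by rewrite linearB /= row_mul rowK mulmxKV.
apply: (min_m i _ lt_m'); exists (u *m M), (w *m M); split; last by rewrite -mulmxBl.
  rewrite submxMfree //; apply: contraNN uj => /sub_pid_mx -> //.
by rewrite submxMfree // -(vanish_sub_pid_mx w0) submxMl.
Qed.

End Equivalence.

(** * Existence of a first reduced echelon form *)

Section Walls.
Context {F : fieldType} {n : nat}.
Hypothesis nz2 : 2%:R != 0 :> F.
Implicit Types (T S R M : 'M[F]_n) (u v w : 'rV[F]_n).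

Lemma REF1_exists T : sltm T -> exists R, REF1 R /\ sltm_equiv T R.
Proof.
move=> hT; have [M [S [m_ [uM le_m Sm hM min_m]]]] := greedy_basis nz2 hT.
have hS : sltm S by move=> i j le_ij; rewrite Sm ?(leq_trans _ le_ij).
have leadS i : leadcol S i = m_ i.
  apply/eqP; rewrite eqn_leq; apply/andP; split; first by apply/leadcol_leP/Sm.
  rewrite leqNgt; apply/negP => lt_m.
  apply: (min_m i i _ (delta_mx 0 i) (row i S) lt_m) => //.
  - by rewrite mxE !eqxx oner_neq0.
  - by move=> l /(leadcol_leP _ _ _ (leqnn _)); rewrite mxE.
  by rewrite -row_sub_mul -rowE.
(* For [j] beyond [i], the vector [y_j] was already a candidate when [y_i] was chosen, so minimality
   gives [m_ i <= m_ j]. *)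
have mono (i j : 'I_n) : (i <= j)%N -> (leadcol S i <= leadcol S j)%N.
  move=> le_ij; rewrite !leadS leqNgt; apply/negP => lt_m.
  apply: (min_m i j _ (delta_mx 0 j) (row j S) lt_m) => //.
  - by rewrite mxE !eqxx oner_neq0.
  - by move=> l /Sm; rewrite mxE.
  by rewrite -row_sub_mul -rowE.
exists S; split; last first.
  by apply: (sltm_equiv_sym nz2) => //; apply: sltm_equiv_of_zprod uM hM.
split=> //; right; split=> [r r' r0 r'0|r c lead|r r' c c' def_r' leadr leadr'].
- rewrite ltnNge; apply/negP => /mono; move/eqP: r0; rewrite -leadcol_eq0 => /eqP ->.
  by rewrite leqn0 leadcol_eq0 => /eqP.
- suff [i0 lt_i0 D_neq0] : exists2 i0 : 'I_n, (i0 < c)%N & Delta 2%:R i0 c r S <> 0.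
    by split; [rewrite ltnS (leq_ltn_trans _ lt_i0) | exists i0].
  apply: contrapT => noD.
  have D0 (i0 : 'I_n) : (i0 < c)%N -> Delta 2%:R i0 c r S = 0.
    by move=> lt_i0; apply: contrapT => D_neq0; apply: noD; exists i0.
  have lt_cr : (c < r)%N by have := leadcol_sltm r hS; rewrite lead.
  set t := S r c; pose a := t / 2%:R.
  (* Left of the leader, the vanishing of all [Delta] reads [S r j = - a * S c j]; at the leader the
     entry is [t = 2a]. *)
  have def_r : row r S = a *+ 2 *: delta_mx 0 c - a *: row c S.
    apply/rowP => j; rewrite !mxE eqxx /=.
    have a2 : a *+ 2 = t by rewrite -mulr_natr mulfVK.
    have [lt_jc|lt_cj|/val_inj ->] := ltngtP j c.
    + have /eqP := D0 j lt_jc; rewrite /Delta addr_eq0 => /eqP D0j.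
      rewrite -val_eqE ltn_eqF // mulr0 sub0r; apply: (mulfI nz2).
      by rewrite D0j /a -/t; field.
    + rewrite -val_eqE gtn_eqF // (hS c j) 1?ltnW // !mulr0 subr0.
      by apply: (leadcol_leP _ _ _ (leqnn _)); rewrite lead.
    by rewrite eqxx (hS c c) // mulr0 subr0 mulr1 a2.
  have lt_cm : (c < m_ r)%N by rewrite -leadS lead.
  (* The competitor is [y_r - a y_c]: its [v] has coordinates [- a *: row c S], supported on indices
     below [c], although [c < m_ r]. *)
  apply: (min_m r r c (delta_mx 0 r - a *: delta_mx 0 c) (- (a *: row c S)) lt_cm) => //.
  + by rewrite !mxE !eqxx -val_eqE gtn_eqF //= mulr0 subr0 oner_neq0.
  + by move=> l le_cl; rewrite !mxE hS // mulr0 oppr0.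
  rewrite opprK !mulmxDl !mulNmx -!scalemxAl -!rowE -row_mul.
  apply: zprod_clear_leader.
    have := hM r; rewrite row_sub_mul def_r !mulmxBl -!scalemxAl -!rowE.
    by rewrite -row_mul.
  by have := hM c; rewrite linearB.
by have := mono r r'; rewrite def_r' leadr leadr' ltnS => -> //.
Qed.

(** * Leader columns of a 1-REF and the associated filtration *)

Lemma REF1_sltm R : REF1 R -> sltm R.
Proof. by case. Qed.

(** Condition (3) compares only consecutive nonzero rows; since zero rows come first, induction on
    [s - r] extends it to all pairs. *)
Lemma REF1_leadcol_mono R (r s : 'I_n) : REF1 R -> (r <= s)%N ->
  (leadcol R r <= leadcol R s)%N.
Proof.
move=> [hR [->|[zero_rows _ leaders]]].
  by move=> _; apply/leadcol_leP => j; rewrite mxE.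
have [k def_k] : exists k, k = (s - r)%N by exists (s - r)%N.
elim: k s def_k => [|k IHk] s def_k le_rs.
  have -> // : r = s by apply/val_inj/eqP; rewrite eqn_leq le_rs -subn_eq0 -def_k.
have lt_s1 : (s.-1 < n)%N by apply: leq_ltn_trans (leq_pred _) (ltn_ord s).
have lt_rs : (r < s)%N by rewrite -subn_gt0 -def_k.
have def_s : s = (Ordinal lt_s1).+1 :> nat by rewrite /= (ltn_predK lt_rs).
apply: leq_trans (IHk (Ordinal lt_s1) _ _) _.
- by rewrite /= -subn1 subnAC -def_k subn1.
- by rewrite -ltnS -def_s.
set q := Ordinal _ in def_s *.
have [->|] := posnP (leadcol R q); first by [].
case/leadcol_ltn => c leadq _.
have [/eqP s0|] := posnP (leadcol R s).
  have q0 : row q R <> 0 by move/eqP; rewrite -leadcol_eq0 leadq.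
  move: s0; rewrite leadcol_eq0 => /eqP s0.
  by have := zero_rows _ _ s0 q0; rewrite def_s ltnNge leqnSn.
case/leadcol_ltn => c' leads _.
by rewrite leadq leads ltnS (leaders _ _ _ _ def_s).
Qed.

(** Membership in the span of the first [a] generators, the form taken by every step of the
    filtration. *)
Definition vanish a u := forall j : 'I_n, (a <= j)%N -> u 0 j = 0.

(* If u (u - w) = 0 with w in span(X_j : j < a) and X_i is the last generator
   occurring in u, then c_i <= a: otherwise, with c the leader column of row i,
   the coefficients of X_i X_c, X_c X_k and X_i X_k force Delta^(2)_(k,c,i) = 0
   for all k < c. *)
Lemma REF1_top R a u w (i : 'I_n) : REF1 R -> zprod R u (u - w) -> vanish a w ->
  u 0 i != 0 -> vanish i.+1 u -> (leadcol R i <= a)%N.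
Proof.
move=> [hR [->|[_ lead2 _]]] uw0 wa ui0 u_top.
  by apply/leadcol_leP => j; rewrite mxE.
rewrite leqNgt; apply/negP => /leadcol_ltn[c leadi le_ac].
have [_ [k [lt_kc]]] := lead2 _ _ leadi; apply.
have lt_ci : (c < i)%N by have := leadcol_sltm i hR; rewrite leadi.
have eic : u 0 i * R i c + 2%:R * u 0 c = 0.
  have := uw0 _ _ lt_ci; rewrite /prodcoef !mxE (wa c) // (wa i) ?(leq_trans le_ac (ltnW _)) //.
  move=> e; apply: (mulfI ui0); rewrite mulr0 -[RHS]e; ring.
have uc0 : u 0 c != 0.
  apply/eqP => uc0; move/eqP: eic; rewrite uc0 mulr0 addr0 mulf_eq0.
  by rewrite (negbTE ui0) (negbTE (leader_neq0 leadi)).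
have eck : u 0 c * R c k + 2%:R * u 0 k - w 0 k = 0.
  have := uw0 _ _ lt_kc; rewrite /prodcoef !mxE (wa c) //.
  move=> e; apply: (mulfI uc0); rewrite mulr0 -[RHS]e; ring.
have eik : u 0 i * R i k + 2%:R * u 0 k - w 0 k = 0.
  have := uw0 _ _ (ltn_trans lt_kc lt_ci).
  rewrite /prodcoef !mxE (wa i) ?(leq_trans le_ac (ltnW _)) //.
  move=> e; apply: (mulfI ui0); rewrite mulr0 -[RHS]e; ring.
apply: (mulfI ui0); rewrite mulr0 /Delta.
have -> : u 0 i * (2%:R * R i k + R i c * R c k) =
    2%:R * (u 0 i * R i k + 2%:R * u 0 k - w 0 k)
    - 2%:R * (u 0 c * R c k + 2%:R * u 0 k - w 0 k)
    + R c k * (u 0 i * R i c + 2%:R * u 0 c) by ring.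
by rewrite eic eck eik !mulr0 subr0 addr0.
Qed.

(** When no leader lies beyond [a] the value is [n], so the next step of the filtration is then the
    whole space. *)
Definition next R a : nat := find (fun r => a < leadcol R r)%N (enum 'I_n).

Lemma next_le R a : (next R a <= n)%N.
Proof. by rewrite -[X in (_ <= X)%N]size_enum_ord find_size. Qed.

Lemma ltn_next R a (i : 'I_n) : (i < next R a)%N -> (leadcol R i <= a)%N.
Proof. by move=> /(before_find i)/negbT; rewrite nth_ord_enum -leqNgt. Qed.

Lemma next_geq R a (i : 'I_n) : REF1 R -> (next R a <= i)%N -> (a < leadcol R i)%N.
Proof.
move=> hR le_i; have lt_n := leq_ltn_trans le_i (ltn_ord i).
apply: leq_trans (REF1_leadcol_mono hR (_ : Ordinal lt_n <= i)%N) => //.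
have /(nth_find i) : has (fun r => a < leadcol R r)%N (enum 'I_n).
  by rewrite has_find size_enum_ord.
by rewrite -/(next R a) -[next R a]/(val (Ordinal lt_n)) nth_ord_enum.
Qed.

Lemma min_row_find (P : pred 'I_n) : min_row P = onth (enum 'I_n) (find P (enum 'I_n)).
Proof. by rewrite /min_row; elim: (enum _) => //= x s IHs; case: ifP. Qed.

(** For [i] below [next R a] the vector [row i R] lies in the span for [a], so the [i]-th relator
    maps to a product [y (y - w) = 0] in A(R') with [w] in that span. [REF1_top] then places the
    last generator of [y] before [next R' a]. *)
Lemma next_vanish R R' M a u : REF1 R -> REF1 R' ->
  (forall u w, zprod R u w -> zprod R' (u *m M) (w *m M)) ->
  (forall u, vanish a u -> vanish a (u *m M)) ->
  vanish (next R a) u -> vanish (next R' a) (u *m M).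
Proof.
move=> hR hR' hM Ma ub j le_j; rewrite mulmx_sum_row summxE big1 // => i _.
have [lt_i|le_i] := ltnP i (next R a); last by rewrite ub // scale0r mxE.
rewrite mxE; apply/eqP; rewrite mulf_eq0; apply/orP; right.
apply: contraTT le_j => Mij; rewrite -ltnNge.
have [k Mik max_k] := arg_maxnP (P := fun k => row i M 0 k != 0) val Mij.
apply: leq_ltn_trans (max_k j Mij) _; rewrite ltnNge; apply/negP => /(next_geq hR').
rewrite ltnNge => /negP; apply.
apply: (REF1_top (u := row i M) (w := row i R *m M)) => //.
- rewrite [row i M]rowE -mulmxBl; apply: hM; apply: zprod_relator => //.
  exact: REF1_sltm.
- apply: Ma => l le_al; rewrite mxE.
  exact: (leadcol_leP _ _ _ (ltn_next lt_i)).
by move=> l; apply: contraTeq => /max_k; rewrite -ltnNge ltnS.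
Qed.

(** Comparison of dimensions: an invertible matrix maps one coordinate span injectively into the
    other. *)
Lemma vanish_le M b b' : M \in unitmx -> (b <= n)%N -> (b' <= n)%N ->
  (forall u, vanish b u -> vanish b' (u *m M)) -> (b <= b')%N.
Proof.
move=> uM le_bn le_b'n hM; rewrite -(@rank_pid_mx F n n b) // -(mxrankMfree _ (B := M)).
  have -> : (pid_mx b : 'M_n) *m M = pid_mx b *m M *m (pid_mx b' : 'M_n).
    apply/row_matrixP => i; rewrite row_mul [RHS]row_mul row_mul.
    apply/esym/vanish_sub_pid_mx/hM/sub_pid_mx; exact: row_sub.
  by rewrite (leq_trans (mxrankM_maxr _ _)) // rank_pid_mx.
by rewrite row_free_unit.
Qed.

(** * Invariance of the wall under isomorphism *)

Section Invariance.
Variables (R R' M : 'M[F]_n).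
Hypotheses (hR : REF1 R) (hR' : REF1 R') (uM : M \in unitmx).
Hypothesis hM : forall u w, zprod R u w <-> zprod R' (u *m M) (w *m M).

Definition stable a := forall u, vanish a u <-> vanish a (u *m M).

(** [next_vanish] for [M] and for its inverse gives inclusions both ways, and dimensions force the
    two indices to agree. *)
Lemma next_stable a : stable a -> next R a = next R' a /\ stable (next R a).
Proof.
move=> Ma.
have Mb u : vanish (next R a) u -> vanish (next R' a) (u *m M).
  by apply: next_vanish => // [v w /hM//|v /Ma].
have Nb u : vanish (next R' a) u -> vanish (next R a) (u *m invmx M).
  apply: next_vanish => // [v w h|v h]; first by apply/hM; rewrite !mulmxKV.
  by apply/Ma; rewrite mulmxKV.
have eq_next : next R a = next R' a.
  apply/eqP; rewrite eqn_leq (vanish_le uM) ?next_le //=.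
  by rewrite (vanish_le (M := invmx M)) ?unitmx_inv ?next_le.
split=> // u; split; first by rewrite [in X in _ -> X]eq_next; apply: Mb.
by move=> h; rewrite -[u](mulmxK uM); apply: Nb; rewrite -eq_next.
Qed.

Lemma stable0 : stable 0.
Proof.
move=> u; split=> hu.
  by have -> : u = 0; [apply/rowP => j; rewrite hu // mxE | rewrite mul0mx => j; rewrite mxE].
have uM0 : u *m M = 0 by apply/rowP => j; rewrite hu // mxE.
by rewrite -[u](mulmxK uM) uM0 mul0mx => j; rewrite mxE.
Qed.

Lemma stable_min_row a : stable a ->
  min_row (fun r => a < leadcol R r)%N = min_row (fun r => a < leadcol R' r)%N.
Proof. by move=> /next_stable[eq_next _]; rewrite !min_row_find -!/(next _ _) eq_next. Qed.

Lemma min_row_next S a r : min_row (fun r => a < leadcol S r)%N = Some r ->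
  next S a = r.
Proof.
rewrite min_row_find -/(next S a) => def_r.
have lt_n : (next S a < n)%N.
  by rewrite ltnNge; apply/negP => le_n; move: def_r; rewrite onth_default // size_enum_ord.
by have := congr1 val (onth_nth r _ _ _ def_r); rewrite /= nth_enum_ord.
Qed.

Lemma eq_wall_from k (r : 'I_n) : stable r -> wall_from R k r = wall_from R' k r.
Proof.
elim: k r => [|k IHk] r //= Mr; congr (_ :: _).
(* The condition [r < r'] in the recursion follows from [r < leadcol S r'], because leaders lie
   strictly below the diagonal. *)
have rows S : sltm S -> min_row (fun r' : 'I_n => (r < r') && (r < leadcol S r'))%N =
    min_row (fun r' => r < leadcol S r')%N.
  move=> hS; congr ohead; apply: eq_filter => r'.
  by apply: andb_idl => /leq_trans; apply; apply: leadcol_sltm.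
have [sR sR'] := (REF1_sltm hR, REF1_sltm hR'); rewrite !rows //.
rewrite -(stable_min_row Mr); case def_r': (min_row _) => [r'|] //.
by apply: IHk; rewrite -(min_row_next def_r'); case: (next_stable Mr).
Qed.

(** The first nonzero row is the step of the same recursion starting at [a = 0], where the span is
    zero and hence stable. *)
Lemma eq_wallREF : wallREF R = wallREF R'.
Proof.
have rows S : min_row (fun r => row r S != 0) = min_row (fun r => 0 < leadcol S r)%N.
  by congr ohead; apply: eq_filter => r; rewrite lt0n leadcol_eq0.
rewrite /wallREF !rows -(stable_min_row stable0); case def_r: (min_row _) => [r|] //.
by apply: eq_wall_from; rewrite -(min_row_next def_r); case: (next_stable stable0).
Qed.

End Invariance.

Lemma is_wall_REF1 T R : sltm T -> REF1 R -> sltm_equiv T R -> is_wall T (wallREF R).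
Proof.
move=> hT hR TR; have sR := REF1_sltm hR; split; first by exists R.
move=> R' hR' TR'; have sR' := REF1_sltm hR'.
have : sltm_equiv R' R.
  by apply: (sltm_equiv_trans nz2 (S := T)) => //; apply: (sltm_equiv_sym nz2).
by case/sltm_equivP => // M uM hM; apply: eq_wallREF hM.
Qed.

End Walls.

Theorem corollary3p26 (F : fieldType) (charF : 2%N \notin [pchar F]%R)
    (n : nat) (T S : 'M[F]_n) (hT : sltm T) (hS : sltm S) :
  sltm_equiv T S -> exists w : seq nat, is_wall T w /\ is_wall S w.
Proof.
have nz2 : 2%:R != 0 :> F by apply: contraNneq charF => two0; rewrite inE two0 eqxx.
move=> TS; have [R [hR TR]] := REF1_exists nz2 hT; have sR := REF1_sltm hR.
(* A single 1-REF [R] of [T] serves both matrices, since [S] is equivalent to [R] through [T]. *)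
exists (wallREF R); split; apply: is_wall_REF1 => //.
by apply: (sltm_equiv_trans nz2 (S := T)) => //; apply: (sltm_equiv_sym nz2).
Qed.
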